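(* Let $G_1,G_2$ be locally finite (weighted) graphs, $\pi:V(G_1)\to V(G_2)$ a map, and $u_1,v_1\in V(G_1)$ with $\pi(u_1)=u$, $\pi(v_1)=v$. If $\pi$ is a left semicovering, then $c(G_2,u\to v)=\sum_{v_j\in\pi^{-1}(v)}c(G_1,u_1\to v_j)$. If $\pi$ is a right semicovering, then $c(G_2,u\to v)=\sum_{u_i\in\pi^{-1}(u)}c(G_1,u_i\to v_1)$. If $\pi$ is a weak covering, both equalities hold.
   Context: Weights lie in a commutative ring $Z$; unweighted graphs are treated as weighted with $Z=\mathbb{Z}$, $w\equiv1$. The weight matrix is $W(G)_{uv}=\sum w(e)$ over edges from $u$ to $v$ (an undirected edge between $u,v$ counts as an edge from $u$ to $v$ and from $v$ to $u$). A map $\pi:V(G_1)\to V(G_2)$ is a left semicovering if it is surjective and $W(G_2)_{uv}=\sum_{v_j\in\pi^{-1}(v)}W(G_1)_{u_1v_j}$ for all $u,v\in V(G_2)$ and all $u_1\in\pi^{-1}(u)$; a right semicovering if it is surjective and $W(G_2)_{uv}=\sum_{u_i\in\pi^{-1}(u)}W(G_1)_{u_iv_1}$ for all $u,v\in V(G_2)$ and all $v_1\in\pi^{-1}(v)$; a weak covering if it is both. A walk of length $n$ from $u$ to $v$ is a sequence of vertices $u=x_0,\dots,x_n=v$ with edges $e_i$ from $x_{i-1}$ to $x_i$; its weight is $\prod w(e_i)$; $c_n(G,u\to v)$ is the sum of weights of such walks ($c_0=\delta_{uv}$) and $c(G,u\to v)=\sum_nc_n(G,u\to v)t^n/n!$.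 *)

(* Defs.v *)
From HB Require Import structures.
From mathcomp Require Import all_boot all_order all_algebra.
From mathcomp Require Import boolp classical_sets functions cardinality fsbigop.

Set Implicit Arguments.
Unset Strict Implicit.
Unset Printing Implicit Defensive.

Import GRing.Theory.
Local Open Scope classical_set_scope.
Local Open Scope ring_scope.

(* Possibly infinite graphs whose edges may be directed or undirected, with
   loops and multiple edges allowed.  An unweighted graph is the case
   Z = int, weight = fun=> 1. *)
Record wgraph (Z : comPzRingType) := WGraph {
  vertex : choiceType;
  edge : choiceType;
  src : edge -> vertex;
  tgt : edge -> vertex;
  undirected : pred edge;  (* src and tgt are then merely the two ends *)
  weight : edge -> Z
}.

Section Graphs.
Variables (Z : comPzRingType) (G : wgraph Z).
Implicit Types (u v : vertex G) (e : edge G).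

(* Being a proposition on e, this makes an undirected loop at u a single edge
   from u to u, both in W and among the steps of a walk. *)
Definition edge_from_to e u v : Prop :=
  (src e = u /\ tgt e = v) \/ (undirected e /\ src e = v /\ tgt e = u).

Definition locally_finite : Prop :=
  forall u, finite_set [set e : edge G | src e = u \/ tgt e = u].

(* \sum_(x \in A) F x is 0 when F has infinite support on A; in a locally
   finite graph the index sets in W and cn are finite. *)
Definition W u v : Z := \sum_(e \in [set e | edge_from_to e u v]) weight e.

(* A pair (x, e) of the vertices x_0, ..., x_n and the edges, where e_i joins
   x_i to x_(i+1) for 0 <= i < n. *)
Definition walks (n : nat) u v : set (n.+1.-tuple (vertex G) * n.-tuple (edge G)) :=
  [set p | [/\ tnth p.1 ord0 = u, tnth p.1 ord_max = v &
     forall i : 'I_n,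
       edge_from_to (tnth p.2 i) (tnth p.1 (inord i)) (tnth p.1 (inord i.+1))]].
Arguments walks : clear implicits.

Definition cn (n : nat) u v : Z :=
  \sum_(p \in walks n u v) \prod_(i < n) weight (tnth p.2 i).

End Graphs.

(* Exponential formal power series: a : egf Z stands for
   \sum_n a n * (t ^ n / n!), the t ^ n / n! being formal basis elements, so
   that n! need not be invertible, or even regular, in Z. *)
Definition egf (Z : comPzRingType) : Type := nat -> Z.

(* Sums of possibly infinite families of series, as when a fibre is infinite:
   for each n, only finitely many members have a nonzero n-th coefficient, and
   the sum is taken coefficientwise. *)
Definition egf_summable (Z : comPzRingType) (I : choiceType) (A : set I)
    (F : I -> egf Z) : Prop :=
  forall n, finite_set [set i | A i /\ F i n <> 0].

Definition egf_sum (Z : comPzRingType) (I : choiceType) (A : set I)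
    (F : I -> egf Z) : egf Z :=
  fun n => \sum_(i \in A) F i n.

Definition egf_is_sum (Z : comPzRingType) (I : choiceType) (A : set I)
    (F : I -> egf Z) (s : egf Z) : Prop :=
  egf_summable A F /\ s = egf_sum A F.

Definition c (Z : comPzRingType) (G : wgraph Z) (u v : vertex G) : egf Z :=
  fun n => cn n u v.

Section Coverings.
Variables (Z : comPzRingType) (G1 G2 : wgraph Z) (pi : vertex G1 -> vertex G2).

(* For G1 locally finite, the sums below have finite support even when the
   fibre is infinite. *)
Definition left_semicovering : Prop :=
  (forall v, exists v1, pi v1 = v) /\
  forall (u v : vertex G2) (u1 : vertex G1), pi u1 = u ->
    W u v = \sum_(vj \in pi @^-1` [set v]) W u1 vj.

Definition right_semicovering : Prop :=
  (forall v, exists v1, pi v1 = v) /\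
  forall (u v : vertex G2) (v1 : vertex G1), pi v1 = v ->
    W u v = \sum_(ui \in pi @^-1` [set u]) W ui v1.

Definition weak_covering : Prop := left_semicovering /\ right_semicovering.

End Coverings.

(* Main.v *)
Require Import Defs.
From HB Require Import structures.
From mathcomp Require Import all_boot all_order all_algebra.
From mathcomp Require Import boolp classical_sets functions cardinality fsbigop.

(** By splitting off the first edge of a walk, [cn n] is the [n]-th power of the
    weight matrix.  Let [P] be the matrix with [P w v = 1] if [pi w = v] and
    [0] otherwise.  Then [pi] is a left semicovering exactly when it is onto and
    [W1 P = P W2], whence [W1^n P = P W2^n], which is the claim for the
    coefficients of [t^n / n!].  Right semicoverings satisfy the same equation
    for the transposes of [W1] and [W2].  Local finiteness makes [W1], [W2] and
    their transposes row-finite; so is [P], although its columns are infinite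
    when the fibres are.  Products with row-finite left factors are
    associative. *)

Set Implicit Arguments.
Unset Strict Implicit.
Unset Printing Implicit Defensive.

Import GRing.Theory.
Local Open Scope classical_set_scope.
Local Open Scope ring_scope.

(** * Sums of finite support *)

Lemma exchange_fsbig_supp (R : Type) (idx : R) (op : Monoid.com_law idx)
    (I J : choiceType) (A P : set I) (B Q : set J) (F : I -> J -> R) :
  finite_set A -> finite_set B ->
  (forall i j, ~ (A i /\ B j) -> F i j = idx) ->
  \big[op/idx]_(i \in P) \big[op/idx]_(j \in Q) F i j
  = \big[op/idx]_(j \in Q) \big[op/idx]_(i \in P) F i j.
Proof.
move=> Afin Bfin F0.
(* Narrowing every sum to the finite sets [A] and [B] reduces the claim to an exchange of finite
   sums, although [P] and [Q] may be infinite. *)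
have narrow (T : choiceType) (C D : set T) (f : T -> R) :
    (forall x, ~ D x -> f x = idx) ->
    \big[op/idx]_(x \in C) f x = \big[op/idx]_(x \in C `&` D) f x.
  move=> f0; apply/esym/fsbig_widen => // x [Cx CDx].
  by apply: f0 => Dx; apply: CDx.
rewrite (narrow _ P A) => [|i Ai]; last by apply: fsbig1 => j _; apply: F0 => -[].
under eq_fsbigr => i _ do
  [rewrite (narrow _ Q B) => [|j Bj]; last by apply: F0 => -[]].
rewrite [RHS](narrow _ Q B) => [|j Bj]; last by apply: fsbig1 => i _; apply: F0 => -[].
under [RHS]eq_fsbigr => j _ do
  [rewrite (narrow _ P A) => [|i Ai]; last by apply: F0 => -[]].
by apply: exchange_fsbig; apply: finite_setIr.
Qed.

(** Membership in [D] and in the fibre become indicators. The double sum then lives on the image of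
    [D] times [D], which is finite, so it can be exchanged; for fixed [i] in [D] only [j = h i]
    contributes. *)
Lemma fsbig_fibers (R : Type) (idx : R) (op : Monoid.com_law idx)
    (I J : choiceType) (h : I -> J) (D : set I) (F : I -> R) :
  finite_set D ->
  \big[op/idx]_(i \in D) F i
  = \big[op/idx]_(j \in [set: J])
      \big[op/idx]_(i \in D `&` h @^-1` [set j]) F i.
Proof.
move=> Dfin; under [RHS]eq_fsbigr do rewrite fsbig_mkcondr fsbig_mkcond.
rewrite (@exchange_fsbig_supp _ _ _ _ _ (h @` D) _ D).
- rewrite [LHS]fsbig_mkcond; apply: eq_fsbigr => i _; rewrite /patch.
  case: ifPn => // Di; last by rewrite fsbig1.
  rewrite -[LHS](@fsbig_set1 _ _ op _ (h i) (fun=> F i)) fsbig_mkcond; apply: eq_fsbigr => j _; rewrite /patch.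
  congr (if _ then _ else _).
  by apply/idP/idP; rewrite !inE /= => ->.
- exact: finite_image.
- exact: Dfin.
- move=> j i nD; rewrite /patch; case: ifPn; rewrite // inE => Di.
  case: ifPn; rewrite // inE /= => hij; case: nD; split=> //.
  by exists i.
Qed.

(** * Row-finite matrices with arbitrary index sets *)

Section Matrices.
Variable Z : comPzRingType.

Definition rowfinite (I J : choiceType) (M : I -> J -> Z) : Prop :=
  forall i, finite_set [set j | M i j <> 0].

Definition mmul (I J K : choiceType) (M : I -> J -> Z) (N : J -> K -> Z) :
    I -> K -> Z :=
  fun i k => \sum_(j \in [set: J]) M i j * N j k.

Definition mtr (I J : choiceType) (M : I -> J -> Z) : J -> I -> Z :=
  fun j i => M i j.

Definition mone (I : choiceType) : I -> I -> Z := fun i j => (i == j)%:R.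

Fixpoint mpow (I : choiceType) (M : I -> I -> Z) (n : nat) : I -> I -> Z :=
  if n is m.+1 then mmul M (mpow M m) else @mone I.

Lemma fsum_deltal (I : choiceType) (i : I) (F : I -> Z) :
  \sum_(j \in [set: I]) (i == j)%:R * F j = F i.
Proof.
rewrite -[RHS](@fsbig_set1 _ _ (@GRing.add Z) _ i F) fsbig_mkcond.
apply: eq_fsbigr => j _; rewrite /patch; have [->|ij] := eqVneq i j.
  by rewrite mul1r ifT// inE.
by rewrite mul0r ifF//; apply/negbTE/negP; rewrite inE /= => ji; rewrite ji eqxx in ij.
Qed.

(** Turns a sum over a fibre into an entry of a product with the 0-1 matrix of [h], as [fsum_deltal]
    does for the choice of a row. *)
Lemma fsum_deltar (I J : choiceType) (h : I -> J) (k : J) (F : I -> Z) :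
  \sum_(i \in [set: I]) F i * (h i == k)%:R = \sum_(i \in h @^-1` [set k]) F i.
Proof.
rewrite [RHS]fsbig_mkcond; apply: eq_fsbigr => j _; rewrite /patch.
case: eqP => hk; first by rewrite mulr1 ifT// inE.
by rewrite mulr0 ifF//; apply/negbTE/negP; rewrite inE.
Qed.

Lemma mmul1 (I J : choiceType) (M : I -> J -> Z) : mmul (@mone I) M = M.
Proof. by apply/funext => i; apply/funext => j; exact: fsum_deltal. Qed.

Lemma mmulr1 (I J : choiceType) (M : I -> J -> Z) : mmul M (@mone J) = M.
Proof.
apply/funext => i; apply/funext => j.
rewrite -[RHS](fsum_deltal j (M i)); apply: eq_fsbigr => k _.
by rewrite mulrC /mone eq_sym.
Qed.

Lemma fsum_neq0 (I : choiceType) (P : set I) (F : I -> Z) :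
  \sum_(i \in P) F i <> 0 -> exists2 i, P i & F i <> 0.
Proof.
apply: contra_notP => nF; apply: fsbig1 => i Pi.
by apply: contrapT => Fi0; apply: nF; exists i.
Qed.

Lemma rowfinite_delta (I J : choiceType) (h : I -> J) :
  rowfinite (fun i j => (h i == j)%:R).
Proof.
move=> i; apply: sub_finite_set (finite_set1 (h i)) => j /=.
by case: eqP.
Qed.

(** Row [i] of the product is supported on the union of the supports of those finitely many rows of
    [N] that row [i] of [M] meets. *)
Lemma rowfinite_mul (I J K : choiceType) (M : I -> J -> Z) (N : J -> K -> Z) :
  rowfinite M -> rowfinite N -> rowfinite (mmul M N).
Proof.
move=> Mfin Nfin i.
apply: (@sub_finite_set _ _
  (\bigcup_(j in [set j | M i j <> 0]) [set k | N j k <> 0])).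
  move=> k /= /fsum_neq0[j _ MN0].
  exists j => /=; first by move=> M0; apply: MN0; rewrite M0 mul0r.
  by move=> N0; apply: MN0; rewrite N0 mulr0.
by apply: bigcup_finite => // j _; exact: Nfin.
Qed.

(** For fixed [i], the factor [M i j * N j k] confines [j] and [k] to finite sets, whatever [P] is,
    so the two summations can be exchanged. *)
Lemma mmulA (I J K L : choiceType) (M : I -> J -> Z) (N : J -> K -> Z)
    (P : K -> L -> Z) :
  rowfinite M -> rowfinite N -> mmul M (mmul N P) = mmul (mmul M N) P.
Proof.
move=> Mfin Nfin; apply/funext => i; apply/funext => l; rewrite /mmul.
(* Distributing a factor needs finite support: an infinite sum is 0 by default, while zero divisors
   could leave finitely many nonzero products. *)
have suppE (T : choiceType) (f : T -> Z) :
    finite_set [set x | f x <> 0] -> forall g : T -> Z,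
    finite_set (setT `&` (fun x => f x * g x) @^-1` [set~ 0]).
  move=> ffin g; apply: sub_finite_set ffin => x [_ fg0] /= f0.
  by apply: fg0; rewrite /= f0 mul0r.
under eq_fsbigr => j _ do
  [rewrite full_fsbig_distrr; last exact: suppE].
rewrite (@exchange_fsbig_supp _ _ _ _ _ [set j | M i j <> 0] _
  (\bigcup_(j in [set j | M i j <> 0]) [set k | N j k <> 0])).
- apply: eq_fsbigr => k _; rewrite [RHS]mulrC full_fsbig_distrr; last exact: suppE.
  by apply: eq_fsbigr => j _ /=; rewrite mulrA mulrC.
- exact: Mfin.
- by apply: bigcup_finite => // j _; exact: Nfin.
- move=> j k nMN /=; have [->|/eqP M0] := eqVneq (M i j) 0; first by rewrite mul0r.
  have [->|/eqP N0] := eqVneq (N j k) 0; first by rewrite mul0r mulr0.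
  by case: nMN; split=> //; exists j.
Qed.

Lemma mtr_mul (I J K : choiceType) (M : I -> J -> Z) (N : J -> K -> Z) :
  mtr (mmul M N) = mmul (mtr N) (mtr M).
Proof.
apply/funext => k; apply/funext => i; apply: eq_fsbigr => j _.
by rewrite mulrC.
Qed.

Lemma rowfinite_pow (I : choiceType) (M : I -> I -> Z) n :
  rowfinite M -> rowfinite (mpow M n).
Proof.
move=> Mfin; elim: n => [|n IHn] /=; first exact: (@rowfinite_delta _ _ id).
exact: rowfinite_mul.
Qed.

Lemma mpow_intertwine (I J : choiceType) (M : I -> I -> Z) (N : J -> J -> Z)
    (P : I -> J -> Z) n :
  rowfinite M -> rowfinite N -> rowfinite P ->
  mmul M P = mmul P N -> mmul (mpow M n) P = mmul P (mpow N n).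
Proof.
move=> Mfin Nfin Pfin MP; elim: n => [|n IHn] /=; first by rewrite mmul1 mmulr1.
(* [M (M^n P) = M (P N^n) = (M P) N^n = (P N) N^n = P (N N^n)]. *)
rewrite -mmulA ?IHn ?mmulA ?MP//; exact: rowfinite_pow.
Qed.

Lemma mpow_tr (I : choiceType) (M : I -> I -> Z) n :
  rowfinite M -> mpow (mtr M) n = mtr (mpow M n).
Proof.
move=> Mfin; elim: n => [|n /= ->].
  by apply/funext => i; apply/funext => j; rewrite /mtr /= /mone eq_sym.
(* Transposition reverses the factors, so [M^n M = M M^n] is required: this is intertwining with
   [P = N = M]. *)
by rewrite -mtr_mul (mpow_intertwine n Mfin Mfin Mfin erefl).
Qed.

End Matrices.

(** * Walks in a locally finite graph *)

Arguments walks {Z G} n u v.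

Section Walks.
Variables (Z : comPzRingType) (G : wgraph Z).
Hypothesis Gfin : locally_finite G.
Implicit Types (u v w : vertex G) (e : edge G) (n : nat).

Lemma finite_edge_from_to u v : finite_set [set e | edge_from_to e u v].
Proof.
apply: sub_finite_set (Gfin u) => e /= [[-> _]|[_ [_ ->]]]; [by left|by right].
Qed.

(** Both directions are included so as to bound the rows of [W] and of its transpose at once. *)
Lemma finite_neighbours u :
  finite_set [set v | exists e, edge_from_to e u v \/ edge_from_to e v u].
Proof.
apply: (@sub_finite_set _ _ ((@src Z G) @` [set e | src e = u \/ tgt e = u] `|`
  (@tgt Z G) @` [set e | src e = u \/ tgt e = u])); last first.
  by rewrite finite_setU; split; apply: finite_image; exact: Gfin.
by move=> v [e [[[su tv]|[_ [sv tu]]]|[[sv tu]|[_ [su tv]]]]];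
  [right|left|left|right]; exists e => //=; auto.
Qed.

Lemma W_neq0 u v : W u v <> 0 -> exists e, edge_from_to e u v.
Proof. by move=> /fsum_neq0[e ue _]; exists e. Qed.

Lemma rowfinite_W : rowfinite (@W Z G).
Proof.
move=> u; apply: sub_finite_set (finite_neighbours u) => v /W_neq0[e uev].
by exists e; left.
Qed.

Lemma rowfinite_trW : rowfinite (mtr (@W Z G)).
Proof.
move=> u; apply: sub_finite_set (finite_neighbours u) => v /W_neq0[e uev].
by exists e; right.
Qed.

Lemma walks_cons n u v x (t : n.+1.-tuple (vertex G)) e (s : n.-tuple (edge G)) :
  walks n.+1 u v (cons_tuple x t, cons_tuple e s) <->
  [/\ x = u, edge_from_to e x (thead t) & walks n (thead t) v (t, s)].
Proof.
(* Walks index their vertices through [inord]; these identities match position [k + 1] of a tuple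
   with position [k] of its tail. *)
have liftE k : (k <= n)%N -> inord k.+1 = lift ord0 (inord k : 'I_n.+1) :> 'I_n.+2.
  by move=> kn; apply: val_inj; rewrite /= /bump /= !inordK.
have i0 : inord 0 = ord0 :> 'I_n.+2 by apply: val_inj; rewrite /= inordK.
have i0' : inord 0 = ord0 :> 'I_n.+1 by apply: val_inj; rewrite /= inordK.
have omE : ord_max = lift ord0 ord_max :> 'I_n.+2 by apply: val_inj.
split.
  case=> /= xu tv st; rewrite omE tnthS in tv; split=> //.
    by have := st ord0; rewrite tnth0 i0 tnth0 liftE// tnthS i0'.
  split=> //= i; have := st (lift ord0 i).
  by rewrite tnthS lift0 !liftE ?tnthS// ltnW.
case=> xu ext [/= _ tv st]; split=> //=; first by rewrite omE tnthS.
move=> i; case: (unliftP ord0 i) => [j ->|->].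
  by rewrite tnthS lift0 !liftE ?tnthS// ltnW.
by rewrite tnth0 i0 tnth0 liftE// tnthS i0'.
Qed.

Lemma walks0 u v :
  walks 0 u v = [set p | p = (in_tuple [:: u], [tuple]) /\ u = v].
Proof.
apply/seteqP; split=> -[t s] /=.
  case=> /= tu tv _; rewrite (tuple0 s); have := tv; have := tu.
  case/tupleP: t {tu tv} => x t; rewrite (tuple0 t) => <-.
  rewrite tnth0 => xv; split; last first.
    by rewrite -xv -[in LHS](tnth0 x [tuple]); congr tnth; apply: val_inj.
  by congr (_, _); apply: val_inj.
by case=> -[-> ->] <-; split=> //; case.
Qed.

Lemma cn0 u v : cn 0 u v = (u == v)%:R.
Proof.
rewrite /cn walks0; case: (u =P v) => uv.
  rewrite (_ : [set _ | _] = [set (in_tuple [:: u], [tuple])]).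
    by rewrite fsbig_set1 big_ord0.
  by apply/seteqP; split=> p /= => [[]|].
by rewrite fsbig1// => p [].
Qed.

(** By induction: finitely many edges can come first, and the rest of the walk starts at one of
    finitely many neighbours of [u]. *)
Lemma finite_walks n u v : finite_set (walks n u v).
Proof.
elim: n u => [|n IHn] u.
  by apply: sub_finite_set (finite_set1 (in_tuple [:: u], [tuple])) => p;
    rewrite walks0 => -[].
pose E := [set e : edge G | src e = u \/ tgt e = u].
pose N := [set w | exists e, edge_from_to e u w \/ edge_from_to e w u].
pose D := E `*` \bigcup_(w in N) walks n w v.
have Dfin : finite_set D.
  apply: finite_setX; first exact: Gfin.
  by apply: bigcup_finite => [|w _]; [exact: finite_neighbours|exact: IHn].
apply: sub_finite_set
  (finite_image (fun p => (cons_tuple u p.2.1, cons_tuple p.1 p.2.2)) Dfin).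
move=> -[t s]; case/tupleP: t => x t; case/tupleP: s => e s.
move=> /walks_cons[-> uet wt]; exists (e, (t, s)) => //; split => /=.
  by case: uet => [[? _]|[_ [_ ?]]]; [left|right].
by exists (thead t) => //; exists e; left.
Qed.

Lemma cnS n u v : cn n.+1 u v = \sum_(w \in [set: vertex G]) W u w * cn n w v.
Proof.
(* Walks are grouped by their second vertex [w]; below, [h] glues an edge from [u] to [w] onto a
   walk from [w] to [v]. *)
rewrite /cn (fsbig_fibers _ (fun p => tnth p.1 (inord 1)) _ (finite_walks _ _ _)).
apply: eq_fsbigr => w _.
pose h (p : edge G * (n.+1.-tuple (vertex G) * n.-tuple (edge G))) :=
  (cons_tuple u p.2.1, cons_tuple p.1 p.2.2).
have i1 : inord 1 = lift ord0 ord0 :> 'I_n.+2.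
  by apply: val_inj; rewrite /= inordK.
rewrite (reindex_fsbig h ([set e | edge_from_to e u w] `*` walks n w v)).
  rewrite mulrC full_fsbig_distrr; last by apply/finite_setIl/finite_edge_from_to.
  under [RHS]eq_fsbigr => e _ do
    [rewrite /= mulrC full_fsbig_distrr; last by apply/finite_setIl/finite_walks].
  rewrite pair_fsbig; [|exact: finite_edge_from_to|exact: finite_walks].
  apply: eq_fsbigr => -[e [t s]] _ /=; rewrite big_ord_recl tnth0; congr (_ * _).
  by apply: eq_bigr => i _; rewrite tnthS.
(* [h] maps into the group of [w], is injective, and is onto it. *)
split.
- move=> [e [t s]] /= [/= uew wt]; have tw : thead t = w by case: wt.
  split; last by rewrite /= i1 tnthS.
  by apply/walks_cons; rewrite tw.
- by move=> [e [t s]] [e' [t' s']] _ _ /= [/val_inj-> -> /val_inj->].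
- move=> [t s]; case/tupleP: t => x t; case/tupleP: s => e s.
  move=> [/walks_cons[-> uet wt]] /=; rewrite i1 tnthS => tw.
  by exists (e, (t, s)) => //=; split => /=; rewrite -tw.
Qed.

Lemma cnE n : @cn Z G n = mpow (@W Z G) n.
Proof.
elim: n => [|n IHn]; apply/funext => u; apply/funext => v; first exact: cn0.
by rewrite cnS /= -IHn.
Qed.

End Walks.

(** * Semicoverings as intertwining relations *)

Lemma fsum_mpow_semicover (Z : comPzRingType) (I J : choiceType)
    (M : I -> I -> Z) (N : J -> J -> Z) (h : I -> J) :
  rowfinite M -> rowfinite N ->
  (forall i k, N (h i) k = \sum_(j \in h @^-1` [set k]) M i j) ->
  forall n i k,
    mpow N n (h i) k = \sum_(j \in h @^-1` [set k]) mpow M n i j.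
Proof.
move=> Mfin Nfin MN n i k.
(* The two sides become the [(i, k)] entries of [P N^n] and [M^n P]; for [n = 1] their equality is
   the hypothesis [MN]. *)
rewrite -(fsum_deltal (h i) (fun j => mpow N n j k)) -fsum_deltar.
pose P i j : Z := (h i == j)%:R; rewrite -/(mmul P (mpow N n) i k).
rewrite -(mpow_intertwine n Mfin Nfin (@rowfinite_delta Z _ _ h)) //.
apply/funext => i'; apply/funext => k'.
by rewrite /mmul fsum_deltar fsum_deltal MN.
Qed.

Theorem theorem13 (Z : comPzRingType) (G1 G2 : wgraph Z)
    (hG1 : locally_finite G1) (hG2 : locally_finite G2)
    (pi : vertex G1 -> vertex G2) (u1 v1 : vertex G1) (u v : vertex G2)
    (hu : pi u1 = u) (hv : pi v1 = v) :
  [/\ left_semicovering pi ->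
        egf_is_sum (pi @^-1` [set v]) (fun vj => c u1 vj) (c u v),
      right_semicovering pi ->
        egf_is_sum (pi @^-1` [set u]) (fun ui => c ui v1) (c u v) &
      weak_covering pi ->
        egf_is_sum (pi @^-1` [set v]) (fun vj => c u1 vj) (c u v) /\
        egf_is_sum (pi @^-1` [set u]) (fun ui => c ui v1) (c u v)].
Proof.
have leftP : left_semicovering pi ->
    egf_is_sum (pi @^-1` [set v]) (fun vj => c u1 vj) (c u v).
  case=> _ Wpi; split=> [n|].
    (* The nonzero [n]-th coefficients lie in row [u1] of [W^n], which has finite support. *)
    rewrite /c cnE//; apply: sub_finite_set (rowfinite_pow n (rowfinite_W hG1) u1).
    by move=> ? [].
  apply/funext => n; rewrite /c /egf_sum !cnE// -hu.
  apply: fsum_mpow_semicover; [exact: rowfinite_W..|].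
  by move=> i k; exact: Wpi.
have rightP : right_semicovering pi ->
    egf_is_sum (pi @^-1` [set u]) (fun ui => c ui v1) (c u v).
  (* Transposing makes the fixed endpoint [v1] the row index, so the argument for left semicoverings
     carries over. *)
  case=> _ Wpi; have mpowE (G : wgraph Z) (x y : vertex G) n :
      locally_finite G -> cn n x y = mpow (mtr (@W Z G)) n y x.
    by move=> hG; rewrite cnE// mpow_tr//; exact: rowfinite_W.
  split=> [n|].
    rewrite /c; under eq_set => i do rewrite mpowE//.
    apply: sub_finite_set (rowfinite_pow n (rowfinite_trW hG1) v1).
    by move=> ? [].
  apply/funext => n; rewrite /c /egf_sum mpowE// -hv.
  under [RHS]eq_fsbigr do rewrite mpowE//.
  apply: fsum_mpow_semicover; [exact: rowfinite_trW..|].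
  by move=> i k; exact: Wpi.
by split=> // -[/leftP ? /rightP].
Qed.
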